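(* Let $m\in\mathbb N$ and suppose the non-empty finite sets $A_1,\dots,A_m\subset\mathbb N$ form an $m$-part non-inclusive sum-and-distance system. For $j\in\{1,\dots,m\}$ let \[\tilde A_j:=\tfrac12\max A_j+\tfrac12\bigl(A_j\cup(-A_j)\bigr)=\Bigl\{\tfrac{\max A_j-a}{2},\tfrac{\max A_j+a}{2}: a\in A_j\Bigr\}.\] Then $\tilde A_1,\dots,\tilde A_m$ form an $m$-part sum system in which every component set has even cardinality. Conversely, suppose $\tilde A_1,\dots,\tilde A_m\subset\mathbb N_0$ form an $m$-part sum system in which every component set has even cardinality. For each $j$, write the elements of $\tilde A_j$ as $0=\alpha_1<\alpha_2<\dots<\alpha_{2\nu_j}$ and let \[A_j:=\{\alpha_{\nu_j+k}-\alpha_{\nu_j+1-k}: k\in\{1,\dots,\nu_j\}\}.\] Then $A_1,\dots,A_m$ form an $m$-part non-inclusive sum-and-distance system.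
   Context: $\mathbb N=\{1,2,\dots\}$, $\mathbb N_0=\mathbb N\cup\{0\}$, and for $N\in\mathbb N$, $\langle N\rangle:=\{0,1,\dots,N-1\}$. For sets $A,B\subset\mathbb R$ and reals $a,b$: $A+B=\{x+y:x\in A,y\in B\}$, $aA+b=\{ax+b:x\in A\}$, $-A=\{-x:x\in A\}$; $|A|$ is cardinality. An $m$-part sum system is a collection of finite sets $A_1,\dots,A_m\subset\mathbb N_0$, each of cardinality at least 2, with $\sum_{k=1}^m A_k=\langle\prod_{k=1}^m|A_k|\rangle$. Finite sets $A_1,\dots,A_m\subset\mathbb N$ form an $m$-part non-inclusive sum-and-distance system if \[\sum_{j=1}^m\bigl(A_j\cup(-A_j)\bigr)=2\Bigl\langle 2^m\prod_{j=1}^m|A_j|\Bigr\rangle-2^m\prod_{j=1}^m|A_j|+1.\] *)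

(* Defs.v *)
From mathcomp Require Import all_boot all_order all_algebra.
From mathcomp Require Import finmap.
From mathcomp Require Import reals.

Set Implicit Arguments.
Unset Strict Implicit.
Unset Printing Implicit Defensive.

Import Order.TTheory GRing.Theory Num.Theory.
Local Open Scope fset_scope.
Local Open Scope ring_scope.

Section SumSystems.
Variable R : realType.
Implicit Types (A B : {fset R}) (m N i k : nat).

Definition addfs A B : {fset R} := [fset x + y | x in A, y in B].

Definition affine (a : R) A (b : R) : {fset R} := [fset a * x + b | x in A].

Definition oppfs A : {fset R} := [fset - x | x in A].

Definition sumfs m (A : 'I_m -> {fset R}) : {fset R} :=
  \big[addfs/[fset 0]]_(j < m) A j.

(* <N> = {0, 1, ..., N - 1} *)
Definition initial N : {fset R} := [fset n%:R | n in iota 0 N].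

Definition symmetrized A : {fset R} := A `|` oppfs A.

Definition increasing_enum A : seq R := sort <=%R A.

(* Numbered from 1, so that A = {alpha A 1 < ... < alpha A #|` A|}. *)
Definition alpha A i : R := nth 0 (increasing_enum A) i.-1.

(* The maximum of A when A is nonempty, 0 otherwise. *)
Definition maxfs A : R := last 0 (increasing_enum A).

Definition sum_system m (A : 'I_m -> {fset R}) : Prop :=
  [/\ forall j, {in A j, forall x, x \is a Num.nat},
      forall j, (2 <= #|` A j|)%N
    & sumfs A = initial (\prod_(j < m) #|` A j|)%N].

(* The component sets may be empty here; their elements are positive. *)
Definition noninclusive_sum_and_distance_system m (A : 'I_m -> {fset R}) : Prop :=
  let N := (2 ^ m * \prod_(j < m) #|` A j|)%N in
  (forall j, {in A j, forall x, x \is a Num.nat /\ 0 < x}) /\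
  sumfs (fun j => symmetrized (A j)) = affine 2 (initial N) (- N%:R + 1).

Definition tilde A : {fset R} :=
  affine (1 / 2) (symmetrized A) (1 / 2 * maxfs A).

(* With #|` A| = 2 nu: {alpha_(nu + k) - alpha_(nu + 1 - k) : 1 <= k <= nu}. *)
Definition central_differences A : {fset R} :=
  let nu := (#|` A| %/ 2)%N in
  [fset alpha A (nu + k) - alpha A (nu + 1 - k) | k in iota 1 nu].

End SumSystems.

(* Main.v *)
Require Import Defs.
From mathcomp Require Import all_boot all_order all_algebra all_field.
From mathcomp Require Import finmap.
From mathcomp Require Import reals.
From mathcomp Require Import zify lra.

Set Implicit Arguments.
Unset Strict Implicit.
Unset Printing Implicit Defensive.

Import Order.TTheory GRing.Theory Num.Theory.
Local Open Scope fset_scope.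
Local Open Scope ring_scope.

(** Writing [M_j = max A_j], the sets [tilde A_j] and [A_j ∪ -A_j] differ by
    the affine map [x ↦ (x + M_j) / 2], and the sum of the [M_j] is the largest
    element of the sumset; as each [tilde A_j] contains [0], it lies in the
    sumset and so consists of natural numbers.

    For the converse the point is that every component [B] of a sum system is
    invariant under [x ↦ max B - x].  The generating polynomials of the
    components multiply to [1 + X + ... + X^(N-1)], so each is a real polynomial
    whose roots are simple roots of unity.  Its roots are thus closed under
    inversion, and as its constant and leading coefficients are both 1, it is
    palindromic.  Reflection turns the central differences, together with their
    opposites, into the set [2 B - max B]. *)

Definition reciprocal_poly (R : nzSemiRingType) (p : {poly R}) : {poly R} :=
  \poly_(i < size p) p`_((size p).-1 - i).

Lemma coef_reciprocal_poly (R : nzSemiRingType) (p : {poly R}) i :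
  (i < size p)%N -> (reciprocal_poly p)`_i = p`_((size p).-1 - i).
Proof. by rewrite coef_poly => ->. Qed.

Lemma size_reciprocal_poly (R : nzSemiRingType) (p : {poly R}) :
  p`_0 != 0 -> size (reciprocal_poly p) = size p.
Proof. by move=> p0; rewrite size_poly_eq // subnn. Qed.

Lemma lead_coef_reciprocal_poly (R : nzSemiRingType) (p : {poly R}) :
  p`_0 != 0 -> lead_coef (reciprocal_poly p) = p`_0.
Proof.
move=> p0; rewrite lead_coef_poly ?subnn // size_poly_gt0.
by apply: contraNneq p0 => ->; rewrite coef0.
Qed.

Lemma horner_reciprocal_poly (F : fieldType) (p : {poly F}) z :
  z != 0 -> (reciprocal_poly p).[z] = z ^+ (size p).-1 * p.[z^-1].
Proof.
move=> z0; rewrite horner_poly horner_coef mulr_sumr (reindex_inj rev_ord_inj).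
move: (size p) => s; apply: eq_bigr => -[k ks] _ /=.
have -> : (s.-1 - (s - k.+1) = k)%N by lia.
have -> : (s.-1 = s - k.+1 + k)%N by lia.
by rewrite exprD exprVn mulrCA mulfK ?expf_neq0.
Qed.

Lemma reciprocal_poly_separable (F : closedFieldType) (p : {poly F}) :
  separable_poly p -> (forall z, root p z -> root p z^-1) ->
  p`_0 = lead_coef p -> reciprocal_poly p = p.
Proof.
move=> psep proots p0l; have pN0 := separable_poly_neq0 psep.
have p0N0 : p`_0 != 0 by rewrite p0l lead_coef_eq0.
have [r pE] := closed_field_poly_normal p.
have rE z : root p z = (z \in r).
  by rewrite pE rootZ ?lead_coef_eq0 // root_prod_XsubC.
have runiq : uniq r.
  rewrite -separable_prod_XsubC (dvdp_separable _ psep) // pE.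
  by rewrite dvdpZr ?lead_coef_eq0.
rewrite (@all_roots_prod_XsubC _ (reciprocal_poly p) r) ?uniq_rootsE //.
- by rewrite lead_coef_reciprocal_poly // p0l -pE.
- rewrite size_reciprocal_poly // {1}pE size_scale ?lead_coef_eq0 //.
  exact: size_prod_XsubC.
apply/allP => z; rewrite -rE => pz; rewrite rootE horner_reciprocal_poly.
  by rewrite (rootP (proots z pz)) mulr0.
by apply: contraNneq p0N0 => z0; rewrite -horner_coef0 -rootE -z0.
Qed.

Section NumClosedField.
Variable C : numClosedFieldType.
Implicit Types (p : {poly C}) (z : C) (n : nat).

Lemma root_conjC p z :
  p \is a polyOver Num.real -> root p z^* = root p z.
Proof.
move=> /polyOverP preal; rewrite -(fmorph_root Num.conj p z).
by congr root; apply/polyP => i; rewrite coef_map /= conj_Creal.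
Qed.

Lemma unity_root_invC n z : (0 < n)%N -> n.-unity_root z -> z^-1 = z^*.
Proof.
move=> n0 /unity_rootP zn; rewrite invC_norm.
have -> : `|z| = 1.
  by apply/eqP; rewrite -(@pexpr_eq1 _ _ n) // -normrX zn normr1.
by rewrite expr1n invr1 mul1r.
Qed.

(* The roots of p are simple and closed under conjugation, which is inversion on
   roots of unity. *)
Lemma reciprocal_poly_dvd_Xn_sub_1 n p :
  (0 < n)%N -> p %| 'X^n - 1 -> p \is a polyOver Num.real ->
  p`_0 = lead_coef p -> reciprocal_poly p = p.
Proof.
move=> n0 pdvd preal; apply: reciprocal_poly_separable => [|z pz].
  apply: dvdp_separable pdvd _; apply: separable_Xn_sub_1.
  by rewrite pnatr_eq0 -lt0n.
have zn : n.-unity_root z.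
  by rewrite /root_of_unity -dvdp_XsubCl (dvdp_trans _ pdvd) ?dvdp_XsubCl.
by rewrite (unity_root_invC n0 zn) root_conjC.
Qed.

End NumClosedField.

Lemma prodnMl (m k : nat) (n : 'I_m -> nat) :
  (\prod_(j < m) (k * n j) = k ^ m * \prod_(j < m) n j)%N.
Proof. by rewrite big_split prod_nat_const card_ord. Qed.

Section Sumsets.
Variable R : realType.
Implicit Types (A B : {fset R}) (m n N : nat) (c b x : R).

Lemma mem_addfsP A B x :
  reflect (exists2 a, a \in A & exists2 b, b \in B & x = a + b)
          (x \in addfs A B).
Proof. exact: imfset2P. Qed.

Lemma mem_affineP c A b x :
  reflect (exists2 a, a \in A & x = c * a + b) (x \in affine c A b).
Proof. exact: imfsetP. Qed.

Lemma mem_initialP N x :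
  reflect (exists2 n, (n < N)%N & x = n%:R) (x \in initial R N).
Proof.
by apply: (iffP (imfsetP _ _ _ _)) => -[n] /=; rewrite ?mem_iota => nN ->;
  exists n => //=; rewrite mem_iota.
Qed.

Lemma natr_in_initial N n : (n%:R \in initial R N) = (n < N)%N.
Proof.
apply/mem_initialP/idP => [[k kN /eqP]|nN]; last by exists n.
by rewrite eqr_nat => /eqP ->.
Qed.

Lemma mem_symmetrized A x : (x \in symmetrized A) = (x \in A) || (- x \in A).
Proof.
rewrite in_fsetU; congr orb; apply/imfsetP/idP => /= [[y yA ->]|xA].
  by rewrite opprK.
by exists (- x); rewrite ?opprK.
Qed.

Lemma mem_sumfsP m (A : 'I_m -> {fset R}) x :
  x \in sumfs A <->
  exists2 f : 'I_m -> R, (forall j, f j \in A j) & x = \sum_j f j.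
Proof.
rewrite /sumfs; elim: m A x => [|m IHm] A x.
  rewrite big_ord0 in_fset1; split=> [/eqP ->|[f _ ->]].
    by exists (fun=> 0) => [[]|] //; rewrite big_ord0.
  by rewrite big_ord0.
rewrite big_ord_recl; split.
  move=> /mem_addfsP [a aA [b /IHm [f fA ->] ->]].
  exists (fun i => if unlift ord0 i is Some j then f j else a).
    by move=> i; case: unliftP => [j|] ->.
  rewrite big_ord_recl unlift_none; congr (_ + _).
  by apply: eq_bigr => i _; rewrite liftK.
move=> [f fA ->]; apply/mem_addfsP; exists (f ord0) => //.
exists (\sum_(i < m) f (lift ord0 i)); last by rewrite big_ord_recl.
by apply/IHm; exists (fun i => f (lift ord0 i)).
Qed.

Lemma sub_sumfs m (A : 'I_m -> {fset R}) j :
  (forall i, 0 \in A i) -> {subset A j <= sumfs A}.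
Proof.
move=> zeroA x xA; apply/mem_sumfsP.
exists (fun i => if i == j then x else 0) => [i|].
  by case: eqP => [->|].
by rewrite -big_mkcond big_pred1_eq.
Qed.

Lemma sumfs_nat m (A : 'I_m -> {fset R}) :
  (forall j, {subset A j <= Num.nat}) -> {subset sumfs A <= Num.nat}.
Proof.
move=> Anat _ /mem_sumfsP[f fA ->].
by apply: rpred_sum => j _; apply: Anat.
Qed.

Lemma sumfs_affine m (A : 'I_m -> {fset R}) c (b : 'I_m -> R) :
  sumfs (fun j => affine c (A j) (b j)) = affine c (sumfs A) (\sum_j b j).
Proof.
rewrite /sumfs; elim/big_rec3: _ => [|j t S S' _ ->].
  apply/fsetP => x; rewrite in_fset1; apply/eqP/mem_affineP => [->|[a]].
    by exists 0; rewrite ?in_fset1 // mulr0 addr0.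
  by rewrite in_fset1 => /eqP -> ->; rewrite mulr0 addr0.
apply/fsetP => x; apply/mem_addfsP/mem_affineP.
  move=> [_ /mem_affineP[u uA ->] [_ /mem_affineP[v vS ->] ->]].
  exists (u + v); last by rewrite mulrDr addrACA.
  by apply/mem_addfsP; exists u => //; exists v.
move=> [_ /mem_addfsP[u uA [v vS ->]] ->].
exists (c * u + b j); first by apply/mem_affineP; exists u.
exists (c * v + t); last by rewrite mulrDr addrACA.
by apply/mem_affineP; exists v.
Qed.

Lemma affine_comp c d A b e :
  affine c (affine d A b) e = affine (c * d) A (c * b + e).
Proof.
apply/fsetP => x; apply/mem_affineP/mem_affineP.
  move=> [_ /mem_affineP[a aA ->] ->]; exists a => //.
  by rewrite mulrDr mulrA addrA.
move=> [a aA ->]; exists (d * a + b); first by apply/mem_affineP; exists a.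
by rewrite mulrDr mulrA addrA.
Qed.

Lemma affine_id A : affine 1 A 0 = A.
Proof.
apply/fsetP => x; apply/mem_affineP/idP => [[a aA ->]|xA].
  by rewrite mul1r addr0.
by exists x; rewrite // mul1r addr0.
Qed.

Lemma card_affine c A b : c != 0 -> #|` affine c A b| = #|` A|.
Proof.
by move=> c0; rewrite card_imfset //= => x y /addIr; apply: mulfI.
Qed.

Lemma card_initial N : #|` initial R N| = N.
Proof.
rewrite card_imfset /=; last exact: mulrIn (oner_neq0 R).
by rewrite undup_id ?iota_uniq // size_iota. Qed.

Lemma card_symmetrized A :
  {in A, forall x, 0 < x} -> #|` symmetrized A| = (2 * #|` A|)%N.
Proof.
move=> Apos; rewrite cardfsU card_imfset //=; last exact: oppr_inj.
have -> : A `&` oppfs A = fset0.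
  apply/fsetP => x; rewrite in_fsetI in_fset0; apply/negP => /andP[xA].
  by move/imfsetP => [y /= yA xy]; have := Apos _ xA; have := Apos _ yA; lra.
by rewrite cardfs0 subn0 addnn mul2n.
Qed.

Lemma mem_increasing_enum A : increasing_enum A =i A.
Proof. by move=> x; rewrite mem_sort. Qed.

Lemma size_increasing_enum A : size (increasing_enum A) = #|` A|.
Proof. exact: size_sort. Qed.

Lemma mem_nth_increasing_enum A i :
  (i < #|` A|)%N -> nth 0 (increasing_enum A) i \in A.
Proof.
by rewrite -size_increasing_enum -mem_increasing_enum; apply: mem_nth.
Qed.

Lemma increasing_enum_sorted A : sorted <%R (increasing_enum A).
Proof. by rewrite sort_lt_sorted fset_uniq. Qed.

Lemma alpha_in A i : (0 < i <= #|` A|)%N -> alpha A i \in A.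
Proof. by case: i => // i; apply: mem_nth_increasing_enum. Qed.

Lemma alpha1_eq A x :
  x \in A -> {in A, forall y, x <= y} -> alpha A 1 = x.
Proof.
move=> xA xmin; have := increasing_enum_sorted A.
have: alpha A 1 \in A.
  by rewrite alpha_in //= cardfs_gt0; apply/fset0Pn; exists x.
move: xA; rewrite -mem_increasing_enum /alpha.
case: (increasing_enum A) => //= y s; rewrite inE => /orP[/eqP -> //|xs].
by move=> /xmin xy /lt_path_min/allP/(_ x xs); rewrite ltNge xy.
Qed.

Lemma maxfs_in A : A != fset0 -> maxfs A \in A.
Proof.
rewrite -cardfs_gt0 -size_increasing_enum -mem_increasing_enum /maxfs.
by case: (increasing_enum A) => //= a s _; apply: mem_last.
Qed.

Lemma maxfs_ge A : {in A, forall x, x <= maxfs A}.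
Proof.
move=> x; rewrite -mem_increasing_enum => /(nthP 0)[i isz <-].
have sz := leq_ltn_trans (leq0n i) isz.
rewrite /maxfs -nth_last.
rewrite (lt_sorted_leq_nth 0 (increasing_enum_sorted A)) ?inE ?ltn_predL //.
by rewrite -ltnS prednK.
Qed.

Lemma maxfs_eq A x : x \in A -> {in A, forall y, y <= x} -> maxfs A = x.
Proof.
move=> xA xmax; apply/le_anti; rewrite maxfs_ge // xmax // maxfs_in //.
by apply/fset0Pn; exists x.
Qed.

Lemma maxfs_affine c A b :
  0 <= c -> A != fset0 -> maxfs (affine c A b) = c * maxfs A + b.
Proof.
move=> c0 AN0; apply: maxfs_eq => [|_ /mem_affineP[a aA ->]].
  by apply/mem_affineP; exists (maxfs A); rewrite ?maxfs_in.
by rewrite lerD2r ler_wpM2l // maxfs_ge.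
Qed.

Lemma maxfs_initial N : maxfs (initial R N.+1) = N%:R.
Proof.
apply: maxfs_eq => [|_ /mem_initialP[n nN ->]]; last by rewrite ler_nat.
by rewrite natr_in_initial.
Qed.

Lemma maxfs_symmetrized A :
  A != fset0 -> {in A, forall x, 0 <= x} -> maxfs (symmetrized A) = maxfs A.
Proof.
move=> AN0 Age0; apply: maxfs_eq => [|x].
  by rewrite mem_symmetrized maxfs_in.
rewrite mem_symmetrized => /orP[/maxfs_ge //|/Age0].
by have := Age0 _ (maxfs_in AN0); lra.
Qed.

Lemma maxfs_sumfs m (A : 'I_m -> {fset R}) :
  (forall j, A j != fset0) -> maxfs (sumfs A) = \sum_j maxfs (A j).
Proof.
move=> AN0; apply: maxfs_eq => [|_ /mem_sumfsP[f fA ->]].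
  by apply/mem_sumfsP; exists (fun j => maxfs (A j)) => // j; apply: maxfs_in.
by apply: ler_sum => j _; apply: maxfs_ge.
Qed.

Definition sumseq A B : seq R := [seq x + y | x <- A, y <- B].

Lemma mem_sumseq A B : sumseq A B =i addfs A B.
Proof.
move=> x; apply/allpairsP/mem_addfsP => [[[a b] /= [aA bB ->]]|].
  by exists a => //; exists b.
by move=> [a aA [b bB ->]]; exists (a, b).
Qed.

Lemma size_sumseq A B : size (sumseq A B) = (#|` A| * #|` B|)%N.
Proof. exact: size_allpairs. Qed.

Lemma leq_card_addfs A B : (#|` addfs A B| <= #|` A| * #|` B|)%N.
Proof.
rewrite -size_sumseq; apply: (uniq_leq_size (fset_uniq _)) => x.
by rewrite -mem_sumseq.
Qed.

Lemma perm_addfs A B :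
  #|` addfs A B| = (#|` A| * #|` B|)%N -> perm_eq (addfs A B) (sumseq A B).
Proof.
move=> cardAB; have eqAB := mem_sumseq A B; apply: uniq_perm => //.
rewrite (uniq_size_uniq (fset_uniq (addfs A B))) => [|x]; last by rewrite eqAB.
by rewrite size_sumseq -cardAB.
Qed.

Lemma leq_card_sumfs m (A : 'I_m -> {fset R}) :
  (#|` sumfs A| <= \prod_(j < m) #|` A j|)%N.
Proof.
rewrite /sumfs; elim/big_rec2: _ => [|j n S _ SN]; first by rewrite cardfs1.
by apply: leq_trans (leq_card_addfs _ _) _; rewrite leq_mul2l SN orbT.
Qed.

Section GeneratingPolynomial.
Variable K : nzSemiRingType.

Definition genpoly A : {poly K} := \sum_(a <- A) 'X^(Num.truncn a).

Lemma genpoly_over (S : semiringClosed K) A : genpoly A \is a polyOver S.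
Proof. by apply: rpred_sum => a _; apply: polyOverXn. Qed.

Lemma coef_genpoly A n :
  {subset A <= Num.nat} -> (genpoly A)`_n = ((n%:R : R) \in A)%:R.
Proof.
move=> Anat; rewrite coef_sum.
have coefX a : a \in A -> ('X^(Num.truncn a) : {poly K})`_n = (n%:R == a)%:R.
  by move=> aA; rewrite coefXn -(eqr_nat R) truncnK //; apply: Anat.
rewrite big_seq (eq_bigr _ coefX) -big_seq.
have [nA|nA] := boolP (_ \in A).
  rewrite (big_fsetD1 n%:R) //= eqxx big_seq big1 ?addr0 // => a.
  by rewrite !inE eq_sym => /andP[/negPf ->].
by rewrite big_seq big1 // => a; case: eqP nA => // -> /negPf ->.
Qed.

Lemma size_genpoly A :
  A != fset0 -> {subset A <= Num.nat} ->
  size (genpoly A) = (Num.truncn (maxfs A)).+1.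
Proof.
move=> AN0 Anat; have maxK := truncnK (Anat _ (maxfs_in AN0)).
apply/eqP; rewrite eqn_leq; apply/andP; split.
  apply/leq_sizeP => n maxn; rewrite coef_genpoly //.
  case: (boolP (_ \in A)) => // /maxfs_ge.
  by rewrite -maxK ler_nat leqNgt maxn.
rewrite ltnNge; apply/negP => /leq_sizeP/(_ _ (leqnn _))/eqP.
by rewrite coef_genpoly // maxK maxfs_in // oner_eq0.
Qed.

Lemma genpoly_initial N : genpoly (initial R N) = \sum_(i < N) 'X^i.
Proof.
rewrite /genpoly big_imfset /=; last exact: in2W (mulrIn (oner_neq0 R)).
rewrite undup_id ?iota_uniq // -{1}[N]subn0 big_mkord.
by apply: eq_bigr => i _; rewrite natrK.
Qed.

Lemma genpoly_addfs A B :
  {subset A <= Num.nat} -> {subset B <= Num.nat} ->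
  #|` addfs A B| = (#|` A| * #|` B|)%N ->
  genpoly (addfs A B) = genpoly A * genpoly B.
Proof.
move=> Anat Bnat /perm_addfs AB; rewrite /genpoly (perm_big _ AB).
rewrite big_allpairs_dep /= big_distrl /= [LHS]big_seq [RHS]big_seq.
apply: eq_bigr => a aA; rewrite big_distrr /= [LHS]big_seq [RHS]big_seq.
apply: eq_bigr => b bB; rewrite truncnD ?exprD ?Anat //.
exact/natr_ge0/Bnat.
Qed.

Lemma genpoly_sumfs m (A : 'I_m -> {fset R}) :
  (forall j, {subset A j <= Num.nat}) ->
  #|` sumfs A| = (\prod_(j < m) #|` A j|)%N ->
  genpoly (sumfs A) = \prod_(j < m) genpoly (A j).
Proof.
elim: m A => [|m IHm] A Anat.
  by rewrite /sumfs !big_ord0 /genpoly big_seq_fset1 truncn0.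
set S := sumfs (fun j => A (lift ord0 j)).
have -> : sumfs A = addfs (A ord0) S by rewrite /sumfs big_ord_recl.
rewrite !big_ord_recl => cardAS.
have Snat : {subset S <= Num.nat} by apply: sumfs_nat => j; apply: Anat.
have [/cardfs0_eq emptyA|cardA_gt0] := posnP #|` A ord0|.
  have -> : addfs (A ord0) S = fset0.
    by apply/fsetP => x; rewrite emptyA; apply/mem_addfsP => -[].
  by rewrite emptyA /genpoly !big_seq_fset0 mul0r.
have cardS : #|` S| = (\prod_(j < m) #|` A (lift ord0 j)|)%N.
  apply/eqP; rewrite eqn_leq leq_card_sumfs -(leq_pmul2l cardA_gt0) -cardAS.
  exact: leq_card_addfs.
by rewrite genpoly_addfs ?cardS // -IHm.
Qed.

End GeneratingPolynomial.

Definition reflection_invariant c A : Prop := {in A, forall x, c - x \in A}.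

Section SumSystem.
Variables (m : nat) (A : 'I_m -> {fset R}).
Hypothesis sysA : sum_system A.
Let N := (\prod_(j < m) #|` A j|)%N.

Lemma sum_system_nat j : {subset A j <= Num.nat}.
Proof. by have [Anat _ _] := sysA => x; apply: Anat. Qed.

Lemma sum_system_neq0 j : A j != fset0.
Proof. by have [_ /(_ j) cardA _] := sysA; rewrite -cardfs_gt0 ltnW. Qed.

Lemma sum_system_sumfs : sumfs A = initial R N.
Proof. by case: sysA. Qed.

Lemma sum_system_prod_card_gt0 : (0 < N)%N.
Proof. by apply: prodn_gt0 => j; rewrite cardfs_gt0 sum_system_neq0. Qed.

Lemma sum_system_0 j : 0 \in A j.
Proof.
have /mem_sumfsP[f fA /esym/eqP] : 0 \in sumfs A.
  by rewrite sum_system_sumfs (natr_in_initial _ 0) sum_system_prod_card_gt0.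
rewrite psumr_eq0 => [/allP/(_ j)|i _].
  by rewrite mem_index_enum => /(_ isT)/eqP <-.
exact/natr_ge0/(sum_system_nat (fA i)).
Qed.

Lemma sum_system_alpha1 j : alpha (A j) 1 = 0.
Proof.
by apply: alpha1_eq (sum_system_0 j) _ => x /sum_system_nat/natr_ge0.
Qed.

(* The number of sums equals the size of the interval they fill, so each value
   is attained exactly once. *)
Lemma sum_system_genpoly (K : nzSemiRingType) :
  \prod_(j < m) genpoly K (A j) = \sum_(i < N) 'X^i.
Proof.
rewrite -genpoly_initial -sum_system_sumfs genpoly_sumfs //.
  exact: sum_system_nat.
by rewrite sum_system_sumfs card_initial.
Qed.

Lemma sum_system_genpoly_dvd_Xn_sub_1 (F : fieldType) j :
  genpoly F (A j) %| 'X^N - 1.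
Proof.
by rewrite subrX1 -sum_system_genpoly (bigD1 j) //= dvdp_mull // dvdp_mulr.
Qed.

Lemma sum_system_reciprocal_genpoly j :
  reciprocal_poly (genpoly algC (A j)) = genpoly algC (A j).
Proof.
have [Anat AN0] := (sum_system_nat (j := j), sum_system_neq0 j).
apply: reciprocal_poly_dvd_Xn_sub_1 sum_system_prod_card_gt0 _ _ _.
- exact: sum_system_genpoly_dvd_Xn_sub_1.
- exact: genpoly_over.
rewrite lead_coefE size_genpoly // !coef_genpoly // truncnK ?Anat ?maxfs_in //.
by rewrite sum_system_0.
Qed.

Lemma sum_system_reflection j : reflection_invariant (maxfs (A j)) (A j).
Proof.
move=> x xA; have [Anat AN0] := (sum_system_nat (j := j), sum_system_neq0 j).
have [[n nE] [k kE]] := (natrP (Anat _ xA), natrP (Anat _ (maxfs_in AN0))).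
have size_p : size (genpoly algC (A j)) = k.+1.
  by rewrite size_genpoly // kE natrK.
have nk : (n <= k)%N by rewrite -(ler_nat R) -nE -kE maxfs_ge.
have : (reciprocal_poly (genpoly algC (A j)))`_n = (genpoly algC (A j))`_n.
  by rewrite sum_system_reciprocal_genpoly.
rewrite coef_reciprocal_poly size_p ?ltnS // !coef_genpoly //.
rewrite natrB // -nE -kE xA => /eqP.
by case: (_ \in _); rewrite // eq_sym oner_eq0.
Qed.

Lemma sum_system_sum_maxfs : \sum_j maxfs (A j) = N%:R - 1.
Proof.
rewrite -maxfs_sumfs; last exact: sum_system_neq0.
rewrite sum_system_sumfs -(prednK sum_system_prod_card_gt0) maxfs_initial.
by rewrite -natr1 addrK.
Qed.

End SumSystem.

Section CentralDifferences.
Variables (A : {fset R}) (c : R).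
Hypotheses (evenA : ~~ odd #|` A|) (reflA : reflection_invariant c A).
Let s := increasing_enum A.

(* [s] is numbered from 0, so that [i = nu + k - 1]. *)
Lemma mem_central_differencesP x :
  reflect (exists2 i, (#|` A| %/ 2 <= i < #|` A|)%N &
             x = nth 0 s i - nth 0 s (#|` A| - i.+1))
          (x \in central_differences A).
Proof.
have ev := evenA; rewrite /central_differences; set n := #|` A| in ev *.
have nE : n = ((n %/ 2) * 2)%N by move: ev; lia.
apply: (iffP (imfsetP _ _ _ _)) => /=.
  move=> [k]; rewrite mem_iota => kn ->; exists (n %/ 2 + k).-1; first lia.
  by rewrite /alpha; congr (nth _ _ _ - nth _ _ _); lia.
move=> [i iA ->]; exists (i - n %/ 2).+1; first by rewrite mem_iota; lia.
by rewrite /alpha; congr (nth _ _ _ - nth _ _ _); lia.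
Qed.

Lemma central_differences_gt0 : {in central_differences A, forall x, 0 < x}.
Proof.
move=> _ /mem_central_differencesP[i iA ->]; rewrite subr_gt0.
have := lt_sorted_ltn_nth 0 (increasing_enum_sorted A) => ->;
  rewrite ?inE ?size_increasing_enum; lia.
Qed.

Lemma central_differences_nat :
  {subset A <= Num.nat} -> {subset central_differences A <= Num.nat}.
Proof.
move=> Anat x xD; have := central_differences_gt0 xD.
case/mem_central_differencesP: xD => i /andP[ni iA] -> {x}.
have i'A : (#|` A| - i.+1 < #|` A|)%N by lia.
have /natrP[a ->] := Anat _ (mem_nth_increasing_enum iA).
have /natrP[b ->] := Anat _ (mem_nth_increasing_enum i'A).
by rewrite subr_gt0 ltr_nat => ba; rewrite -natrB ?natr_nat // ltnW.
Qed.

Lemma increasing_enum_reflection : s = rev [seq c - x | x <- s].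
Proof.
apply: lt_sorted_eq; first exact: increasing_enum_sorted.
  rewrite rev_sorted sorted_map; apply: sub_sorted (increasing_enum_sorted A).
  by move=> x y /= xy; rewrite ltrD2l ltrN2.
move=> x; rewrite mem_rev mem_increasing_enum; apply/idP/mapP => [xA|[y]].
  exists (c - x); first by rewrite mem_increasing_enum reflA.
  by rewrite opprB addrC subrK.
by rewrite mem_increasing_enum => yA ->; apply: reflA.
Qed.

Lemma nth_increasing_enum_reflection i :
  (i < #|` A|)%N -> nth 0 s (#|` A| - i.+1) = c - nth 0 s i.
Proof.
rewrite -size_increasing_enum -/s => iA; rewrite {1}increasing_enum_reflection.
by rewrite nth_rev ?size_map ?subnSK ?leq_subr // subKn ?(nth_map 0) // ltnW.
Qed.

Lemma symmetrized_central_differences :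
  symmetrized (central_differences A) = affine 2 A (- c).
Proof.
have diffE i : (i < #|` A|)%N ->
    nth 0 s i - nth 0 s (#|` A| - i.+1) = 2 * nth 0 s i - c.
  by move=> iA; rewrite nth_increasing_enum_reflection //; lra.
apply/fsetP => x; rewrite mem_symmetrized; apply/orP/mem_affineP.
  move=> [] /mem_central_differencesP[i /andP[_ iA]]; rewrite diffE // => xE.
    by exists (nth 0 s i); rewrite ?mem_nth_increasing_enum.
  by exists (c - nth 0 s i); [exact/reflA/mem_nth_increasing_enum | lra].
move=> [a]; rewrite -mem_increasing_enum => /(nthP 0)[i].
rewrite size_increasing_enum => iA <- ->; rewrite -diffE //.
have [ni|ni] := leqP (#|` A| %/ 2) i; [left|right].
  by apply/mem_central_differencesP; exists i; rewrite ?ni.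
apply/mem_central_differencesP; exists (#|` A| - i.+1)%N.
  by lia.
by rewrite opprB; congr (_ - nth _ _ _); lia.
Qed.

Lemma card_central_differences : (2 * #|` central_differences A|)%N = #|` A|.
Proof.
rewrite -card_symmetrized; last exact: central_differences_gt0.
by rewrite symmetrized_central_differences card_affine // pnatr_eq0.
Qed.

End CentralDifferences.

Lemma tildeE A :
  tilde A = [fset (maxfs A - a) / 2 | a in A] `|`
            [fset (maxfs A + a) / 2 | a in A].
Proof.
apply/fsetP => x; rewrite in_fsetU; apply/mem_affineP/orP.
  move=> [a]; rewrite mem_symmetrized => /orP[aA|aA] ->; [right|left];
    by apply/imfsetP => /=; eexists; [exact: aA | lra].
move=> [] /imfsetP[/= a aA ->]; [exists (- a)|exists a];
  by rewrite ?mem_symmetrized ?opprK ?aA ?orbT //; lra.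
Qed.

Lemma tilde0 A : A != fset0 -> 0 \in tilde A.
Proof.
move=> AN0; apply/mem_affineP; exists (- maxfs A); last by lra.
by rewrite mem_symmetrized opprK maxfs_in ?orbT.
Qed.

Lemma card_tilde A :
  {in A, forall x, 0 < x} -> #|` tilde A| = (2 * #|` A|)%N.
Proof.
move=> Apos; rewrite card_affine ?card_symmetrized //.
by rewrite div1r invr_eq0 pnatr_eq0.
Qed.

Section SumAndDistance.
Variables (m : nat) (A : 'I_m -> {fset R}).
Hypotheses (AN0 : forall j, A j != fset0)
  (sysA : noninclusive_sum_and_distance_system A).
Let N := (2 ^ m * \prod_(j < m) #|` A j|)%N.

Lemma sum_and_distance_gt0 j : {in A j, forall x, 0 < x}.
Proof. by case: sysA => Apos _ x /Apos[]. Qed.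

Lemma sum_and_distance_sum_maxfs : \sum_j maxfs (A j) = N%:R - 1.
Proof.
have [_ sumA] := sysA.
have prod_card_gt0 : (0 < N)%N.
  by rewrite muln_gt0 expn_gt0 prodn_gt0 // => j; rewrite cardfs_gt0.
transitivity (\sum_j maxfs (symmetrized (A j))).
  apply: eq_bigr => j _; rewrite maxfs_symmetrized // => x xA.
  exact/ltW/(sum_and_distance_gt0 xA).
rewrite -maxfs_sumfs => [|j]; last by rewrite fsetU_eq0 negb_and AN0.
rewrite sumA -/N maxfs_affine //; last by rewrite -cardfs_gt0 card_initial.
by rewrite -{1}(prednK prod_card_gt0) maxfs_initial -subn1 natrB //; lra.
Qed.

Lemma sum_and_distance_card_tilde :
  (\prod_(j < m) #|` tilde (A j)|)%N = N.
Proof.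
rewrite /N -prodnMl; apply: eq_bigr => j _.
exact/card_tilde/sum_and_distance_gt0.
Qed.

Lemma sum_and_distance_sumfs_tilde :
  sumfs (fun j => tilde (A j)) = initial R N.
Proof.
have [_ sumA] := sysA.
rewrite sumfs_affine sumA -/N affine_comp -mulr_sumr sum_and_distance_sum_maxfs.
by rewrite -[RHS]affine_id; congr affine; lra.
Qed.

Lemma sum_system_tilde : sum_system (fun j => tilde (A j)).
Proof.
split=> [j x xA|j|].
- have : x \in initial R N.
    rewrite -sum_and_distance_sumfs_tilde.
    by apply: sub_sumfs xA => i; apply: tilde0.
  by move=> /mem_initialP[n _ ->]; apply: natr_nat.
- rewrite card_tilde; last exact: sum_and_distance_gt0.
  by rewrite leq_pmulr ?cardfs_gt0.
by rewrite sum_and_distance_card_tilde sum_and_distance_sumfs_tilde.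
Qed.

End SumAndDistance.

Lemma sum_and_distance_central_differences m (A : 'I_m -> {fset R}) :
  sum_system A -> (forall j, ~~ odd #|` A j|) ->
  noninclusive_sum_and_distance_system (fun j => central_differences (A j)).
Proof.
move=> sysA evenA; have reflA := sum_system_reflection sysA.
rewrite /noninclusive_sum_and_distance_system -prodnMl.
under eq_bigr => j _ do rewrite (card_central_differences (evenA j) (reflA j)).
split=> [j x xD|].
  split; last exact: central_differences_gt0 xD.
  exact: central_differences_nat (sum_system_nat sysA (j := j)) _ xD.
transitivity (sumfs (fun j => affine 2 (A j) (- maxfs (A j)))).
  by apply: eq_bigr => j _; apply: symmetrized_central_differences.
rewrite sumfs_affine sum_system_sumfs // sumrN sum_system_sum_maxfs //.
by rewrite opprB addrC.
Qed.

End Sumsets.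

Theorem theorem2 (R : realType) (m : nat) (hm : (0 < m)%N) :
  (forall A : 'I_m -> {fset R},
     (forall j, A j != fset0) ->
     noninclusive_sum_and_distance_system A ->
     [/\ forall j, tilde (A j) =
           [fset (maxfs (A j) - a) / 2 | a in A j] `|`
           [fset (maxfs (A j) + a) / 2 | a in A j],
         sum_system (fun j => tilde (A j))
       & forall j, ~~ odd #|` tilde (A j)|])
  /\
  (forall tA : 'I_m -> {fset R},
     sum_system tA ->
     (forall j, ~~ odd #|` tA j|) ->
     (forall j, alpha (tA j) 1 = 0) /\
     noninclusive_sum_and_distance_system (fun j => central_differences (tA j))).
Proof.
split=> [A AN0 sysA|A sysA evenA]; split.
- by move=> j; apply: tildeE.
- exact: sum_system_tilde.
- by move=> j; rewrite card_tilde ?oddM //; apply: sum_and_distance_gt0.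
- exact: sum_system_alpha1.
- exact: sum_and_distance_central_differences.
Qed.
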